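(* Let $\mathbf{X}\in\mathbb{R}^{n\times p}$, $\beta^*\in\mathbb{R}^p$, $\varepsilon\in\mathbb{R}^n$ and $y=\mathbf{X}\beta^*+\varepsilon$. Let $h:\mathbb{R}^p\to[0,+\infty]$ be a convex, proper function such that the minimization problem $\min_{\beta\in\mathbb{R}^p}\|\mathbf{A}\beta-z\|^2+2h(\beta)$ has at least one solution for every $z\in\mathbb{R}^n$ and every $\mathbf{A}\in\mathbb{R}^{n\times p}$, and let $\hat\beta\in\operatorname*{argmin}_{\beta\in\mathbb{R}^p}\|\mathbf{X}\beta-y\|^2+2h(\beta)$. Assume that $h(\beta^* )<+\infty$ and let $t_0,\gamma>0$. If $$\varepsilon^T\mathbf{X}(\hat\beta-\beta^* )+h(\beta^* )-h(\hat\beta)-\|\mathbf{X}(\hat\beta-\beta^* )\|^2\ \le\ t_0\gamma,$$ then $H(t_0)\le\|\mathbf{X}(\hat\beta-\beta^* )\|+\gamma$.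
   Context: $\|\cdot\|$ is the Euclidean norm. A function is proper if it is finite at at least one point. The function $H:(0,+\infty)\to\mathbb{R}$ (which depends on $\varepsilon$) is defined by $$H(t)=\sup_{\beta\in\mathbb{R}^p:\ \|\mathbf{X}(\beta-\beta^* )\|\le t}\frac{\varepsilon^T\mathbf{X}(\beta-\beta^* )+h(\beta^* )-h(\beta)}{t},\qquad t>0.$$ *)

(* Defs.v *)
From HB Require Import structures.
From mathcomp Require Import all_boot all_order all_algebra.
From mathcomp Require Import all_classical all_reals ereal.

Set Implicit Arguments.
Unset Strict Implicit.
Unset Printing Implicit Defensive.

Import Order.TTheory GRing.Theory Num.Theory.

Local Open Scope classical_set_scope.
Local Open Scope ring_scope.

(* MathComp-Analysis norms matrices by the maximum of the absolute values of
   their entries, so the Euclidean norm has to be introduced separately. *)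
Definition enorm {R : realType} {n : nat} (u : 'cV[R]_n) : R :=
  Num.sqrt (\sum_i u i 0 ^+ 2).

Definition dotp {R : realType} {n : nat} (u v : 'cV[R]_n) : R :=
  (u^T *m v) 0 0.

(* The convention 0 * +oo = 0 of \bar R makes the cases l = 0 and l = 1
   trivially true, also where h is infinite. *)
Definition econvex {R : realType} {E : lmodType R} (h : E -> \bar R) : Prop :=
  forall (x y : E) (l : R), 0 <= l <= 1 ->
    (h (l *: x + (1 - l) *: y)%R <= l%:E * h x + (1 - l)%:E * h y)%E.

Definition eproper {R : realType} {T : Type} (h : T -> \bar R) : Prop :=
  exists x, h x \is a fin_num.

Definition argmin {R : realType} {T : Type} (f : T -> \bar R) : set T :=
  [set x | forall y, (f x <= f y)%E].

Definition objective {R : realType} {n p : nat} (h : 'cV[R]_p -> \bar R)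
    (A : 'M[R]_(n, p)) (z : 'cV[R]_n) (b : 'cV[R]_p) : \bar R :=
  ((enorm (A *m b - z)%R ^+ 2)%:E + 2%:E * h b)%E.

Section Gain.
Context {R : realType} {n p : nat}.
Variables (X : 'M[R]_(n, p)) (eps : 'cV[R]_n) (bstar : 'cV[R]_p).
Variable h : 'cV[R]_p -> \bar R.

Definition gain (b : 'cV[R]_p) : \bar R :=
  ((dotp eps (X *m (b - bstar))%R)%:E + h bstar - h b)%E.

(* The supremum is taken in \bar R: competitors b with h b = +oo contribute
   -oo.  When h >= 0 and h bstar is finite, its value for t > 0 is real. *)
Definition H (t : R) : \bar R :=
  ereal_sup [set (gain b / t%:E)%E |
             b in [set b | enorm (X *m (b - bstar)) <= t]].

End Gain.

(* Main.v *)
(* Convexity upgrades the minimality of bhat to the variational inequality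
   h b >= h bhat + <y - X bhat, X (b - bhat)>.  With u = X (bhat - bstar) and
   w = X (b - bstar) this reads gain b <= gain bhat - |u|^2 + <u, w>, and
   Cauchy-Schwarz bounds <u, w> by t0 |u| as soon as |w| <= t0. *)
Require Import Defs.
From HB Require Import structures.
From mathcomp Require Import all_boot all_order all_algebra.
From mathcomp Require Import all_classical all_reals ereal.
From mathcomp Require Import ring lra.

Set Implicit Arguments.
Unset Strict Implicit.
Unset Printing Implicit Defensive.

Import Order.TTheory GRing.Theory Num.Theory.

Local Open Scope classical_set_scope.
Local Open Scope ring_scope.

Section DotProduct.
Context {R : realType} {n : nat}.
Implicit Types u v w : 'cV[R]_n.

Lemma dotpE u v : dotp u v = \sum_i u i 0 * v i 0.
Proof. by rewrite /dotp mxE; apply: eq_bigr => i _; rewrite mxE. Qed.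

Lemma dotpC u v : dotp u v = dotp v u.
Proof. by rewrite !dotpE; apply: eq_bigr => i _; rewrite mulrC. Qed.

Lemma dotpDr u v w : dotp u (v + w) = dotp u v + dotp u w.
Proof. by rewrite /dotp mulmxDr mxE. Qed.

Lemma dotpDl u v w : dotp (u + v) w = dotp u w + dotp v w.
Proof. by rewrite dotpC dotpDr ![dotp w _]dotpC. Qed.

Lemma dotpZr a u v : dotp u (a *: v) = a * dotp u v.
Proof. by rewrite /dotp -scalemxAr mxE. Qed.

Lemma dotpZl a u v : dotp (a *: u) v = a * dotp u v.
Proof. by rewrite dotpC dotpZr dotpC. Qed.

Lemma dotpNr u v : dotp u (- v) = - dotp u v.
Proof. by rewrite -scaleN1r dotpZr mulN1r. Qed.

Lemma dotpNl u v : dotp (- u) v = - dotp u v.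
Proof. by rewrite dotpC dotpNr dotpC. Qed.

Lemma enorm_ge0 u : 0 <= enorm u.
Proof. exact: sqrtr_ge0. Qed.

Lemma enorm_sqr u : enorm u ^+ 2 = dotp u u.
Proof.
rewrite sqr_sqrtr; last by apply: sumr_ge0 => i _; apply: sqr_ge0.
by rewrite dotpE; apply: eq_bigr => i _; rewrite expr2.
Qed.

Lemma dotp_ge0 u : 0 <= dotp u u.
Proof. by rewrite -enorm_sqr sqr_ge0. Qed.

Lemma enorm_eq0 u : enorm u = 0 -> u = 0.
Proof.
move=> u0; have /esym := enorm_sqr u; rewrite u0 expr0n /= dotpE => s0.
apply/matrixP => i j; rewrite ord1 mxE; apply/eqP.
have /(_ i isT)/eqP : forall i, true -> u i 0 * u i 0 = 0.
  by apply: psumr_eq0P s0 => k _; rewrite -expr2 sqr_ge0.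
by rewrite mulf_eq0 orbb.
Qed.

Lemma dotp0l v : dotp 0 v = 0.
Proof. by rewrite -(scale0r 0) dotpZl mul0r. Qed.

(** Cauchy-Schwarz: the squared norm of [enorm v *: u - enorm u *: v] is 2|u||v|(|u||v| - <u,v>).
    The factor |u||v| can be cancelled only if positive, hence the separate cases of a zero
    vector. *)
Lemma dotp_le_enorm u v : dotp u v <= enorm u * enorm v.
Proof.
have [/enorm_eq0 ->|u0] := eqVneq (enorm u) 0.
  by rewrite dotp0l mulr_ge0 ?enorm_ge0.
have [/enorm_eq0 ->|v0] := eqVneq (enorm v) 0.
  by rewrite dotpC dotp0l mulr_ge0 ?enorm_ge0.
have uv_gt0 : 0 < enorm u * enorm v by rewrite mulr_gt0 ?lt0r ?u0 ?v0 ?enorm_ge0.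
have := dotp_ge0 (enorm v *: u - enorm u *: v).
rewrite !(dotpDl, dotpDr, dotpNl, dotpNr, dotpZl, dotpZr) -!enorm_sqr.
rewrite (dotpC v u) => ge0; rewrite -subr_ge0 -(pmulr_rge0 _ uv_gt0).
lra.
Qed.

End DotProduct.

(** Replaces the passage to the limit l -> 0 by a single well-chosen l. *)
Lemma ge0_of_small_perturbation (R : realFieldType) (a q : R) :
  0 <= q -> (forall l, 0 < l <= 1 -> 0 <= a + l * q) -> 0 <= a.
Proof.
move=> q0 aq; rewrite leNgt; apply/negP => a0.
have d0 : 0 < q - a by lra.
(* If a < 0, this l gives a + l q = -a^2 / (q - a) < 0, a contradiction; l <= 1 because q >= 0. *)
have : 0 < - a / (q - a) <= 1.
  by rewrite divr_gt0 ?oppr_gt0 //= ler_pdivrMr // mul1r; lra.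
move=> /aq; have -> : a + - a / (q - a) * q = - (a ^+ 2 / (q - a)).
  by field; rewrite gt_eqF.
by rewrite oppr_ge0 leNgt divr_gt0 // exprn_even_gt0 //= lt_eqF.
Qed.

Section LeastSquares.
Context {R : realType} {n p : nat}.
Variables (h : 'cV[R]_p -> \bar R) (A : 'M[R]_(n, p)) (z : 'cV[R]_n).

(** The objective is finite at [c], whereas [h b = +oo] would make it infinite at the minimizer
    [b]. *)
Lemma argmin_objective_fin (b c : 'cV[R]_p) :
  (forall x, (0 <= h x)%E) -> argmin (objective h A z) b ->
  (h c < +oo)%E -> h b \is a fin_num.
Proof.
move=> h_ge0 /(_ c) + c_fin; rewrite ge0_fin_numE // /objective.
have : h c \is a fin_num by rewrite ge0_fin_numE.
case: (h c) => // r _; have := h_ge0 b.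
by case: (h b) => //= [s|] _ //; rewrite ?ltry // mulry gtr0_sg // mul1e.
Qed.

(** First-order optimality without derivatives: compare [b] with the points l c + (1 - l) b of the
    segment towards [c], divide by l, and let l tend to 0. *)
Lemma argmin_objective_variational (b c : 'cV[R]_p) (hb hc : R) :
  econvex h -> argmin (objective h A z) b -> h b = hb%:E -> h c = hc%:E ->
  hb + dotp (z - A *m b) (A *m (c - b)) <= hc.
Proof.
move=> h_convex bmin hbE hcE.
set v := A *m b - z; set d := A *m (c - b).
have -> : z - A *m b = - v by rewrite opprB.
(* The factor 2 matches the cross term 2 l <v, d> of |v + l d|^2; the remainder l^2 |d|^2, once
   divided by l, is the perturbation l <d, d>. *)
rewrite dotpNl -subr_ge0 -(pmulr_rge0 _ (ltr0n R 2)).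
apply: (@ge0_of_small_perturbation _ _ (dotp d d)); first exact: dotp_ge0.
move=> l /andP[l0 l1].
have l01 : 0 <= l <= 1 by rewrite ltW.
have hl := h_convex c b l l01.
rewrite hcE hbE -!EFinM -EFinD in hl.
have objl : (objective h A z (l *: c + (1 - l) *: b)%R
    <= (enorm (v + l *: d) ^+ 2 + 2 * (l * hc + (1 - l) * hb))%:E)%E.
  have -> : v + l *: d = A *m (l *: c + (1 - l) *: b) - z.
    rewrite /v /d !mulmxDr mulmxN -!scalemxAr scalerBl scale1r scalerBr.
    by rewrite addrAC addrCA.
  by rewrite EFinD leeD2l // EFinM lee_pmul2l.
have := le_trans (bmin _) objl.
rewrite /objective hbE -EFinM -EFinD lee_fin -/v !enorm_sqr; clearbody v d.
rewrite !(dotpDl, dotpDr, dotpZl, dotpZr) (dotpC d v) => le_l.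
rewrite -(pmulr_rge0 _ l0); lra.
Qed.

End LeastSquares.

Theorem theorem3p2 (R : realType) (n p : nat) (X : 'M[R]_(n, p))
    (bstar : 'cV[R]_p) (eps y : 'cV[R]_n)
    (hy : y = X *m bstar + eps)
    (h : 'cV[R]_p -> \bar R)
    (h_ge0 : forall b, (0 <= h b)%E)
    (h_convex : econvex h)
    (h_proper : eproper h)
    (h_solvable : forall (z : 'cV[R]_n) (A : 'M[R]_(n, p)),
        argmin (objective h A z) !=set0)
    (bhat : 'cV[R]_p)
    (hbhat : argmin (objective h X y) bhat)
    (hbstar : (h bstar < +oo)%E)
    (t0 gamma : R) (t0_gt0 : 0 < t0) (gamma_gt0 : 0 < gamma)
    (hgap : (gain X eps bstar h bhat
               - (enorm (X *m (bhat - bstar))%R ^+ 2)%:E <= (t0 * gamma)%:E)%E) :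
  (H X eps bstar h t0 <= (enorm (X *m (bhat - bstar))%R + gamma)%:E)%E.
Proof.
have hbhat_fin := argmin_objective_fin h_ge0 hbhat hbstar.
have hbstar_fin : h bstar \is a fin_num by rewrite ge0_fin_numE.
case hbhatE : (h bhat) hbhat_fin => [r| |] // _.
case hbstarE : (h bstar) hbstar_fin => [s| |] // _.
apply: ge_ereal_sup => _ [b /= b_t0 <-].
rewrite /gain hbstarE hbhatE -!(EFinD, EFinN, EFinB) lee_fin in hgap *.
(* If [h b = +oo], the quotient is -oo, as t0 > 0; otherwise the variational inequality applies to
   [b]. *)
case hbE : (h b) (h_ge0 b) => [q| |] // _; last first.
  by rewrite addeNy inver gt_eqF // mulNyr gtr0_sg ?invr_gt0 // mul1e leNye.
have := argmin_objective_variational h_convex hbhat hbhatE hbE.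
set u := X *m (bhat - bstar) in hgap *; set w := X *m (b - bstar) in b_t0 *.
(* The residual at [bhat] and the direction from [bhat] to [b] are expressed through [eps], [u] and
   [w], the vectors in [hgap] and in the gain of [b]. *)
have -> : y - X *m bhat = eps - u.
  by rewrite hy /u mulmxBr opprB addrCA addrA addrC; congr (_ + _); rewrite addrC.
have -> : X *m (b - bhat) = w - u.
  by rewrite /u /w -mulmxBr opprB addrA subrK.
rewrite !(dotpDl, dotpDr, dotpNl, dotpNr) -enorm_sqr => vi.
have uw : dotp u w <= enorm u * t0.
  by apply: le_trans (dotp_le_enorm u w) _; rewrite ler_wpM2l ?enorm_ge0.
rewrite inver gt_eqF // -EFinM lee_fin ler_pdivrMr //.
(* [vi] bounds the gain of [b] by the left side of [hgap] plus <u, w>, hence by t0 gamma + t0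
   |u|. *)
lra.
Qed.
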